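(* Let $\mathcal{K}_{2^{\mathbb{N}}}$ be the (Fraïssé) category whose objects are the simplicial $\mathrm{Cu}$-semigroups $\overline{\mathbb{N}}^r$ ($r\ge1$) and whose morphisms are the order-embeddings $\alpha\colon\overline{\mathbb{N}}^r\to\overline{\mathbb{N}}^t$ such that $\alpha(1)=1$, where $1$ denotes the constant tuple $(1,\ldots,1)$. Then the Fraïssé limit of $\mathcal{K}_{2^{\mathbb{N}}}$ is $\mathrm{Lsc}(2^{\mathbb{N}},\overline{\mathbb{N}})$, where $2^{\mathbb{N}}$ is the Cantor set.
   Context: **$\mathrm{Cu}$-semigroups.** For $x,y$ in a partially ordered set, $x\ll y$ means: for every increasing sequence $(z_n)_n$ having a supremum with $y\le\sup_n z_n$, there is $n$ with $x\le z_n$. A $\mathrm{Cu}$-semigroup is a positively ordered (commutative) monoid $S$ such that (O1) every increasing sequence has a supremum; (O2) every element is the supremum of a $\ll$-increasing sequence; (O3) $x'\ll x$ and $y'\ll y$ imply $x'+y'\ll x+y$; (O4) $\sup_n(x_n+y_n)=\sup_n x_n+\sup_n y_n$ for increasing sequences. A $\mathrm{Cu}$-morphism is a monoid morphism preserving the order, the relation $\ll$, and suprema of increasing sequences. $\mathrm{Cu}$ denotes the resulting category; it has inductive limits. An order-embedding between $\mathrm{Cu}$-semigroups always means a $\mathrm{Cu}$-morphism $\alpha$ such that $\alpha(x)\le\alpha(y)$ implies $x\le y$. $S$ is countably-based if there is a countable subset $B\subseteq S$ such that every element of $S$ is the supremum of a $\ll$-increasing sequence in $B$. $\overline{\mathbb{N}}=\{0,1,2,\ldots,\infty\}$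 and $\overline{\mathbb{N}}^r$ carries componentwise order and addition. For a compact metric space $X$, $\mathrm{Lsc}(X,\overline{\mathbb{N}})$ is the monoid of lower-semicontinuous functions $X\to\overline{\mathbb{N}}$ with pointwise order and addition; it is a $\mathrm{Cu}$-semigroup. **Finite-set comparison.** For $\mathrm{Cu}$-morphisms $\alpha,\beta\colon S\to T$ and a finite set $F\subseteq S$, write $\alpha\simeq_F\beta$ if $\alpha(x')\le\beta(x)$ and $\beta(x')\le\alpha(x)$ for all $x',x\in F$ with $x'\ll x$. **Fraïssé limit.** An inductive sequence $(S_i,\sigma_{i,j})_{i\in\mathbb{N}}$ in a subcategory $\mathfrak{c}\subseteq\mathrm{Cu}$ is a Fraïssé sequence if every $S_i$ is countably-based and, for every $i$, every finite $F\subseteq S_i$ and every $\mathfrak{c}$-morphism $\alpha\colon S_i\to C$, there are $j\ge i$ and a $\mathfrak{c}$-morphism $\beta_F\colon C\to S_j$ with $\beta_F\circ\alpha\simeq_F\sigma_{i,j}$. The category $\mathcal{K}_{2^{\mathbb{N}}}$ is a Fraïssé category, so it has a Fraïssé sequence; the Fraïssé limit is the $\mathrm{Cu}$-limit of any Fraïssé sequence (unique up to isomorphism). *)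

(* Defs.v *)
From HB Require Import structures.
From mathcomp Require Import all_boot all_order all_algebra.
From mathcomp Require Import all_classical all_reals all_analysis.
From mathcomp Require Import zify.

Set Implicit Arguments.
Unset Strict Implicit.
Unset Printing Implicit Defensive.

Import Order.TTheory GRing.Theory.

Local Open Scope classical_set_scope.
Local Open Scope ring_scope.
Local Open Scope order_scope.

Record poMonoid (d : Order.disp_t) := POMonoid {
  po_sort :> porderType d;
  po_zero : po_sort;
  po_add : po_sort -> po_sort -> po_sort;
  po_addA : associative po_add;
  po_addC : commutative po_add;
  po_add0 : left_id po_zero po_add;
  po_ge0 : forall x : po_sort, po_zero <= x;
  po_leD : forall x y z t : po_sort,
    x <= y -> z <= t -> po_add x z <= po_add y t
}.

Arguments po_zero {d p}.
Arguments po_add {d p} _ _.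

Definition is_seq_sup (d : Order.disp_t) (T : porderType d) (z : nat -> T)
    (s : T) : Prop :=
  supremums (range z) s.

Definition way_below (d : Order.disp_t) (T : porderType d) (x y : T) : Prop :=
  forall (z : nat -> T) (s : T),
    nondecreasing_seq z -> is_seq_sup z s -> y <= s -> exists n, x <= z n.

Notation "x \ll y" := (way_below x y) (at level 70, no associativity).

Record cuSemigroup (d : Order.disp_t) := CuSemigroup {
  cu_sort :> poMonoid d;
  cu_O1 : forall z : nat -> cu_sort,
    nondecreasing_seq z -> exists s, is_seq_sup z s;
  cu_O2 : forall x : cu_sort, exists z : nat -> cu_sort,
    (forall n, z n \ll z n.+1) /\ is_seq_sup z x;
  cu_O3 : forall x' x y' y : cu_sort,
    x' \ll x -> y' \ll y -> po_add x' y' \ll po_add x y;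
  cu_O4 : forall (u v : nat -> cu_sort) (s t : cu_sort),
    nondecreasing_seq u -> nondecreasing_seq v ->
    is_seq_sup u s -> is_seq_sup v t ->
    is_seq_sup (fun n => po_add (u n) (v n)) (po_add s t)
}.

Record cu_morphism (d d' : Order.disp_t) (S : cuSemigroup d)
    (T : cuSemigroup d') (f : S -> T) : Prop := CuMorphism {
  cu_mor0 : f po_zero = po_zero;
  cu_morD : forall x y, f (po_add x y) = po_add (f x) (f y);
  cu_mor_le : forall x y, x <= y -> f x <= f y;
  cu_mor_way_below : forall x y, x \ll y -> f x \ll f y;
  cu_mor_sup : forall (z : nat -> S) (s : S),
    nondecreasing_seq z -> is_seq_sup z s -> is_seq_sup (f \o z) (f s)
}.

Definition order_embedding (d d' : Order.disp_t) (S : cuSemigroup d)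
    (T : cuSemigroup d') (f : S -> T) : Prop :=
  cu_morphism f /\ forall x y, f x <= f y -> x <= y.

Definition countably_based (d : Order.disp_t) (S : cuSemigroup d) : Prop :=
  exists B : set S, countable B /\
    forall x : S, exists z : nat -> S,
      [/\ forall n, B (z n), forall n, z n \ll z n.+1 & is_seq_sup z x].

Definition approx_on (d d' : Order.disp_t) (S : cuSemigroup d)
    (T : cuSemigroup d') (F : set S) (f g : S -> T) : Prop :=
  forall x' x, F x' -> F x -> x' \ll x -> f x' <= g x /\ g x' <= f x.

Lemma cu_morphism_id (d : Order.disp_t) (S : cuSemigroup d) :
  cu_morphism (@idfun S).
Proof. by split. Qed.

Lemma cu_morphism_comp (d1 d2 d3 : Order.disp_t) (S : cuSemigroup d1)
    (T : cuSemigroup d2) (U : cuSemigroup d3) (f : S -> T) (g : T -> U) :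
  cu_morphism f -> cu_morphism g -> cu_morphism (g \o f).
Proof.
move=> [f0 fD fle fwb fsup] [g0 gD gle gwb gsup]; split => /=.
- by rewrite f0.
- by move=> x y; rewrite fD gD.
- by move=> x y /fle/gle.
- by move=> x y /fwb/gwb.
- move=> z s zinc zs; apply: gsup; last exact: fsup.
  by move=> m n mn; apply/fle/zinc.
Qed.

Lemma order_embedding_id (d : Order.disp_t) (S : cuSemigroup d) :
  order_embedding (@idfun S).
Proof. by split=> //; exact: cu_morphism_id. Qed.

Lemma order_embedding_comp (d1 d2 d3 : Order.disp_t) (S : cuSemigroup d1)
    (T : cuSemigroup d2) (U : cuSemigroup d3) (f : S -> T) (g : T -> U) :
  order_embedding f -> order_embedding g -> order_embedding (g \o f).
Proof.
move=> [fm fe] [gm ge]; split; first exact: cu_morphism_comp.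
by move=> x y /ge/fe.
Qed.

(* A subcategory of Cu, its class of objects being the family [sub_ob]. *)
Record subcategory (d : Order.disp_t) := Subcategory {
  sub_idx :> Type;
  sub_ob : sub_idx -> cuSemigroup d;
  sub_hom : forall a b : sub_idx, (sub_ob a -> sub_ob b) -> Prop;
  sub_hom_cu : forall (a b : sub_idx) (f : sub_ob a -> sub_ob b),
    sub_hom f -> cu_morphism f;
  sub_hom_id : forall a : sub_idx, sub_hom (@idfun (sub_ob a));
  sub_hom_comp : forall (a b c : sub_idx) (f : sub_ob a -> sub_ob b)
      (g : sub_ob b -> sub_ob c),
    sub_hom f -> sub_hom g -> sub_hom (g \o f)
}.

(* The values of [seq_map i j] with [j < i] are irrelevant. *)
Record inductive_sequence (d : Order.disp_t) (C : subcategory d) :=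
  InductiveSequence {
  seq_idx : nat -> C;
  seq_map : forall i j : nat, sub_ob (seq_idx i) -> sub_ob (seq_idx j);
  seq_map_hom : forall i j : nat, (i <= j)%N -> sub_hom (@seq_map i j);
  seq_map_id : forall i : nat, @seq_map i i =1 id;
  seq_map_comp : forall i j k : nat, (i <= j)%N -> (j <= k)%N ->
    @seq_map j k \o @seq_map i j =1 @seq_map i k
}.

Arguments seq_map {d C} _ i j _.

Definition seq_ob (d : Order.disp_t) (C : subcategory d)
    (S : inductive_sequence C) (i : nat) : cuSemigroup d :=
  sub_ob (seq_idx S i).

Definition fraisse_sequence (d : Order.disp_t) (C : subcategory d)
    (S : inductive_sequence C) : Prop :=
  (forall i, countably_based (seq_ob S i)) /\
  forall (i : nat) (F : set (seq_ob S i)), finite_set F ->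
  forall (c : C) (alpha : seq_ob S i -> sub_ob c), sub_hom alpha ->
  exists2 j : nat, (i <= j)%N &
  exists2 beta : sub_ob c -> seq_ob S j, sub_hom beta &
    approx_on F (beta \o alpha) (seq_map S i j).

Definition cu_cocone (d d' : Order.disp_t) (C : subcategory d)
    (S : inductive_sequence C) (T : cuSemigroup d')
    (tau : forall i, seq_ob S i -> T) : Prop :=
  (forall i, cu_morphism (tau i)) /\
  forall i j : nat, (i <= j)%N -> tau j \o seq_map S i j =1 tau i.

(* Inductive limit in the whole category Cu, not merely in [C]. *)
Definition cu_limit (d d' : Order.disp_t) (C : subcategory d)
    (S : inductive_sequence C) (L : cuSemigroup d')
    (lambda : forall i, seq_ob S i -> L) : Prop :=
  cu_cocone lambda /\
  forall (e : Order.disp_t) (T : cuSemigroup e)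
      (tau : forall i, seq_ob S i -> T),
    cu_cocone tau ->
    exists u : L -> T,
      [/\ cu_morphism u, forall i, u \o lambda i =1 tau i &
          forall v : L -> T, cu_morphism v ->
            (forall i, v \o lambda i =1 tau i) -> v =1 u].

(* The existence of a Fraisse sequence is part of the definition: without it the
   second clause could hold vacuously. *)
Definition fraisse_limit (d d' : Order.disp_t) (C : subcategory d)
    (L : cuSemigroup d') : Prop :=
  (exists S : inductive_sequence C, fraisse_sequence S) /\
  forall S : inductive_sequence C, fraisse_sequence S ->
    exists lambda : forall i, seq_ob S i -> L, cu_limit lambda.

Inductive enat : Type := Fin of nat | Infty.

Definition enat_option (x : enat) : option nat :=
  if x is Fin n then Some n else None.
Definition option_enat (x : option nat) : enat :=
  if x is Some n then Fin n else Infty.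
Lemma enat_optionK : cancel enat_option option_enat. Proof. by case. Qed.

HB.instance Definition _ := Countable.copy enat (can_type enat_optionK).

Definition enat_le (x y : enat) : bool :=
  match x, y with
  | _, Infty => true
  | Infty, Fin _ => false
  | Fin m, Fin n => (m <= n)%N
  end.

Definition enat_add (x y : enat) : enat :=
  match x, y with
  | Fin m, Fin n => Fin (m + n)%N
  | _, _ => Infty
  end.

Lemma enat_le_refl : reflexive enat_le. Proof. by case=> //= n. Qed.

Lemma enat_le_anti : antisymmetric enat_le.
Proof. by case=> [m|] [n|] //=; rewrite -eqn_leq => /eqP ->. Qed.

Lemma enat_le_trans : transitive enat_le.
Proof. by case=> [m|] [n|] [p|] //=; exact: leq_trans. Qed.

Lemma enat_le_total : total enat_le.
Proof. by case=> [m|] [n|] //=; exact: leq_total. Qed.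

HB.instance Definition _ := Order.Le_isPOrder.Build Order.default_display enat
  enat_le_refl enat_le_anti enat_le_trans.
HB.instance Definition _ :=
  Order.POrder_isTotal.Build Order.default_display enat enat_le_total.

Lemma enat_addA : associative enat_add.
Proof. by case=> [m|] [n|] [p|] //=; rewrite addnA. Qed.
Lemma enat_addC : commutative enat_add.
Proof. by case=> [m|] [n|] //=; rewrite addnC. Qed.
Lemma enat_add0 : left_id (Fin 0%N) enat_add. Proof. by case. Qed.

HB.instance Definition _ :=
  GRing.isNmodule.Build enat enat_addA enat_addC enat_add0.

Lemma enat_ge0 (x : enat) : (0%R : enat) <= x. Proof. by case: x. Qed.
Lemma enat_leD (x y z t : enat) :
  x <= y -> z <= t -> (x + z)%R <= (y + t)%R.
Proof. by case: x y z t => [x|] [y|] [z|] [t|] //; exact: leq_add. Qed.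


Lemma enat_sup_approx (z : nat -> enat) (s : enat) (k : nat) :
  is_seq_sup z s -> Fin k <= s -> exists n, Fin k <= z n.
Proof.
move=> [_ lub]; case: k => [|k] ks; first by exists 0%N; exact: enat_ge0.
apply: contrapT => /forallNP zk.
have : s <= Fin k.
  apply: lub => _ [n _ <-]; have /negP := zk n.
  by case: (z n) => [m|//]; rewrite /Order.le /= -ltnNge.
by move/(le_trans ks); rewrite /Order.le /= ltnn.
Qed.

Lemma enat_sup_exists (z : nat -> enat) : exists s, is_seq_sup z s.
Proof.
have [[k zk]|/forallNP nb] :=
    pselect (exists k, `[< forall n, z n <= Fin k >]).
  pose P k := `[< forall n, z n <= Fin k >].
  have exP : exists k, P k by exists k.
  case: (ex_minnP exP) => m /asboolP Pm mmin; exists (Fin m); split.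
    by move=> _ [n _ <-].
  move=> [t|] tb; last by [].
  by apply: mmin; apply/asboolP => n; apply: tb; exists n.
exists Infty; split; first by move=> _ [n _ <-]; case: (z n).
move=> [t|//] tb; case: (nb t); apply/asboolP => n.
by apply: tb; exists n.
Qed.

Lemma enat_supD (u v : nat -> enat) (s t : enat) :
  nondecreasing_seq u -> nondecreasing_seq v ->
  is_seq_sup u s -> is_seq_sup v t ->
  is_seq_sup (fun n => (u n + v n)%R) (s + t)%R.
Proof.
move=> uinc vinc us vt; split.
  by move=> _ [n _ <-]; apply: enat_leD; [apply: us.1|apply: vt.1]; exists n.
move=> [b|] ub; last by case: (s + t)%R.
have uvb n : (u n + v n)%R <= Fin b by apply: ub; exists n.
have sb : s <= Fin b.
  apply: us.2 => _ [n _ <-]; apply: le_trans (uvb n).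
  by rewrite -[leLHS]addr0; apply: enat_leD => //; exact: enat_ge0.
have tb : t <= Fin b.
  apply: vt.2 => _ [n _ <-]; apply: le_trans (uvb n).
  by rewrite -[leLHS]add0r; apply: enat_leD => //; exact: enat_ge0.
case: s us sb => [s|//] us _; case: t vt tb => [t|//] vt _.
have [n sn] := enat_sup_approx us (lexx _).
have [m tm] := enat_sup_approx vt (lexx _).
apply: le_trans (uvb (maxn n m)); apply: enat_leD.
  by apply: le_trans sn _; apply: uinc; exact: leq_maxl.
by apply: le_trans tm _; apply: vinc; exact: leq_maxr.
Qed.

Definition enat_sup (z : nat -> enat) : enat := xget Infty (is_seq_sup z).

Lemma enat_supP (z : nat -> enat) : is_seq_sup z (enat_sup z).
Proof.
rewrite /enat_sup; have [s zs] := enat_sup_exists z.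
by apply: xgetPex; exists s.
Qed.

Lemma way_below_le (d : Order.disp_t) (T : porderType d) (x y z t : T) :
  x <= y -> y \ll z -> z <= t -> x \ll t.
Proof.
move=> xy yz zt u s uinc us ts.
have [n yn] := yz u s uinc us (le_trans zt ts).
by exists n; exact: le_trans xy yn.
Qed.

Section Algebraic.
Variables (d : Order.disp_t) (M : poMonoid d) (K : set M).
Hypothesis K_compact : forall x, K x -> x \ll x.
Hypothesis K_add : forall x y, K x -> K y -> K (po_add x y).
Hypothesis K_approx : forall x : M, exists z : nat -> M,
  [/\ nondecreasing_seq z, forall n, K (z n) & is_seq_sup z x].

Lemma algebraic_O2 (x : M) : exists z : nat -> M,
  (forall n, z n \ll z n.+1) /\ is_seq_sup z x.
Proof.
have [z [zinc Kz zx]] := K_approx x; exists z; split=> // n.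
by apply: way_below_le (K_compact (Kz n)) _ => //; exact: zinc.
Qed.

Lemma algebraic_O3 (x' x y' y : M) :
  x' \ll x -> y' \ll y -> po_add x' y' \ll po_add x y.
Proof.
move=> x'x y'y; have [u [uinc Ku ux]] := K_approx x.
have [v [vinc Kv vy]] := K_approx y.
have [n xn] := x'x u x uinc ux (lexx _).
have [m ym] := y'y v y vinc vy (lexx _).
apply: (way_below_le (po_leD xn ym)).
  exact/K_compact/K_add.
by apply: po_leD; [apply: ux.1; exists n|apply: vy.1; exists m].
Qed.
End Algebraic.

Lemma fct_sup (X : Type) (z : nat -> X -> enat) (s : X -> enat) :
  (forall x, is_seq_sup (z^~ x) (s x)) -> is_seq_sup z s.
Proof.
move=> zs; split.
  by move=> _ [n _ <-]; apply/lefP => x; apply: (zs x).1; exists n.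
move=> t tb; apply/lefP => x; apply: (zs x).2 => _ [n _ <-].
by have /lefP : z n <= t by apply: tb; exists n.
Qed.

Lemma fct_ge0 (X : Type) (f : X -> enat) : (0%R : X -> enat) <= f.
Proof. by apply/lefP => x; exact: enat_ge0. Qed.

Lemma fct_leD (X : Type) (f g h k : X -> enat) :
  f <= g -> h <= k -> (f + h)%R <= (g + k)%R.
Proof. by move=> /lefP fg /lefP hk; apply/lefP => x; exact: enat_leD. Qed.

Section Simplicial.
Variable r : nat.

Definition simplicial_po : poMonoid FunOrder.fun_display :=
  @POMonoid FunOrder.fun_display ('I_r -> enat) 0%R +%R
    (@addrA _) (@addrC _) (@add0r _) (@fct_ge0 'I_r) (@fct_leD 'I_r).

Implicit Types (z : nat -> simplicial_po) (f : simplicial_po).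

Lemma simplicial_supP z f :
  is_seq_sup z f <-> forall i, is_seq_sup (z^~ i) (f i).
Proof.
split=> [zf i|]; last exact: fct_sup.
have zs : is_seq_sup z (fun i => enat_sup (z^~ i)).
  by apply: fct_sup => j; exact: enat_supP.
by rewrite (is_subset1_supremums zf zs); exact: enat_supP.
Qed.

Lemma simplicial_O1 z : nondecreasing_seq z -> exists s, is_seq_sup z s.
Proof.
move=> _; exists (fun i => enat_sup (z^~ i)).
by apply/simplicial_supP => i; exact: enat_supP.
Qed.

Let finval : set simplicial_po := [set f | forall i, exists k, f i = Fin k].

Lemma simplicial_compact f : finval f -> f \ll f.
Proof.
move=> ff z s zinc /simplicial_supP zs /lefP fs.
have /choice[n fn] : forall i, exists n, f i <= z n i.
  move=> i; have [k fk] := ff i; rewrite fk.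
  by apply: (enat_sup_approx (zs i)); rewrite -fk.
exists (\max_i n i); apply/lefP => i; apply: le_trans (fn i) _.
by have /lefP := zinc _ _ (leq_bigmax i : (n i <= \max_i n i)%N).
Qed.

Lemma simplicial_finvalD f g : finval f -> finval g -> finval (po_add f g).
Proof.
move=> ff fg i; have [k fk] := ff i; have [l gl] := fg i.
by exists (k + l)%N; rewrite -[LHS]/(f i + g i)%R fk gl.
Qed.

Lemma simplicial_approx f : exists z,
  [/\ nondecreasing_seq z, forall n, finval (z n) & is_seq_sup z f].
Proof.
exists (fun n i => Order.min (f i) (Fin n)); split.
- move=> m n mn; apply/lefP => i; rewrite le_min !ge_min lexx /=.
  by apply/orP; right.
- move=> n i /=; case: (f i) => [k|]; last by exists n.
  by rewrite /Order.min; case: ifP; eexists.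
- apply/simplicial_supP => i; split.
    by move=> _ [n _ <-]; rewrite ge_min lexx.
  move=> t tb; case E : (f i) => [k|].
    have /tb : range (fun n => Order.min (f i) (Fin n)) (Fin k).
      by exists k => //; rewrite E minxx.
    by [].
  case: t tb => // t tb.
  have /tb : range (fun n => Order.min (f i) (Fin n)) (Fin t.+1).
    by exists t.+1 => //; rewrite E /Order.min.
  by rewrite /Order.le /= ltnn.
Qed.

Lemma simplicial_O4 (u v : nat -> simplicial_po) (s t : simplicial_po) :
  nondecreasing_seq u -> nondecreasing_seq v ->
  is_seq_sup u s -> is_seq_sup v t ->
  is_seq_sup (fun n => po_add (u n) (v n)) (po_add s t).
Proof.
move=> uinc vinc /simplicial_supP us /simplicial_supP vt.
apply/simplicial_supP => i; apply: enat_supD => //.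
  by move=> m n /uinc /lefP.
by move=> m n /vinc /lefP.
Qed.

Definition simplicial : cuSemigroup FunOrder.fun_display :=
  @CuSemigroup FunOrder.fun_display simplicial_po simplicial_O1
    (algebraic_O2 simplicial_compact simplicial_approx)
    (algebraic_O3 simplicial_compact simplicial_finvalD simplicial_approx)
    simplicial_O4.
End Simplicial.

Definition simplicial1 (r : nat) : simplicial r := fun=> Fin 1%N.
Arguments simplicial1 : clear implicits.

Definition K_cantor_hom (r t : {r : nat | (0 < r)%N})
    (f : simplicial (val r) -> simplicial (val t)) : Prop :=
  order_embedding f /\ f (simplicial1 (val r)) = simplicial1 (val t).

Lemma K_cantor_hom_comp (r s t : {r : nat | (0 < r)%N})
    (f : simplicial (val r) -> simplicial (val s))
    (g : simplicial (val s) -> simplicial (val t)) :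
  K_cantor_hom f -> K_cantor_hom g -> K_cantor_hom (g \o f).
Proof.
move=> [fe f1] [ge g1]; split; first exact: order_embedding_comp.
by rewrite /= f1 g1.
Qed.

Definition K_cantor : subcategory FunOrder.fun_display :=
  @Subcategory FunOrder.fun_display {r : nat | (0 < r)%N}
    (fun r => simplicial (val r)) K_cantor_hom (fun r t f fh => fh.1.1)
    (fun r => conj (order_embedding_id (simplicial (val r))) erefl)
    K_cantor_hom_comp.

(* Same as [lower_semicontinuous] of the library, which only covers functions
   with values in extended fields. *)
Definition lsc (X : topologicalType) (f : X -> enat) : Prop :=
  forall (x : X) (a : enat), a < f x -> \forall y \near x, a < f y.

Record lsc_type (X : topologicalType) := MkLsc {
  lsc_fun :> X -> enat;
  _ : `[< lsc lsc_fun >]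
}.

HB.instance Definition _ (X : topologicalType) := [isSub for @lsc_fun X].
HB.instance Definition _ (X : topologicalType) :=
  [Choice of lsc_type X by <:].
HB.instance Definition _ (X : topologicalType) :=
  [SubChoice_isSubPOrder of lsc_type X by <: with FunOrder.fun_display].

Lemma enat_ltS (k : nat) (x : enat) : (Fin k < x) = (Fin k.+1 <= x).
Proof. by rewrite ltNge; case: x => [m|//]; rewrite /Order.le /= -ltnNge. Qed.

Lemma enat_leDP (k : nat) (x y : enat) : Fin k <= (x + y)%R ->
  exists m n, [/\ k = (m + n)%N, Fin m <= x & Fin n <= y].
Proof.
case: x y => [m|] [n|] => [kmn|_|_|_].
- exists (minn k m), (k - minn k m)%N.
  have {}kmn : (k <= m + n)%N by [].
  split; rewrite /Order.le /=; lia.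
- by exists 0%N, k.
- by exists k, 0%N; rewrite addn0.
- by exists k, 0%N; rewrite addn0.
Qed.

Section LscTheory.
Variable X : topologicalType.
Implicit Types f g : X -> enat.

Lemma lscP f :
  lsc f <-> forall x k, Fin k <= f x -> \forall y \near x, Fin k <= f y.
Proof.
split=> lf x.
  case=> [_|k]; first by apply: nearW => y; exact: enat_ge0.
  rewrite -enat_ltS => /lf; apply: filterS => y.
  by rewrite enat_ltS.
case=> [k|]; last by rewrite ltNge; case: (f x).
by rewrite enat_ltS => /lf; apply: filterS => y; rewrite enat_ltS.
Qed.

Lemma lsc0 : lsc (0%R : X -> enat).
Proof. by apply/lscP => x k kx; apply: nearW. Qed.

Lemma lscD f g : lsc f -> lsc g -> lsc (f + g)%R.
Proof.
move=> /lscP lf /lscP lg; apply/lscP => x k.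
move=> /enat_leDP[m [n [-> /lf fx /lg gx]]].
by near=> y; apply: (@enat_leD (Fin m) _ (Fin n)); near: y.
Unshelve. all: by end_near. Qed.

Lemma lsc_sup (z : nat -> X -> enat) :
  (forall n, lsc (z n)) -> lsc (fun x => enat_sup (z^~ x)).
Proof.
move=> lz; apply/lscP => x k kx'.
have [n kx] := enat_sup_approx (enat_supP (z^~ x)) kx'.
have /lscP lzn := lz n; apply: filterS (lzn _ _ kx) => y ky.
by apply: le_trans ky _; have [+ _] := enat_supP (z^~ y); apply; exists n.
Qed.

Lemma lsc_funP (f : lsc_type X) : lsc f.
Proof. by case: f => f lf; exact/asboolP. Qed.

Definition lsc_mk f (lf : lsc f) : lsc_type X := MkLsc (introT (asboolP _) lf).

Definition lsc_add (f g : lsc_type X) : lsc_type X :=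
  lsc_mk (lscD (@lsc_funP f) (@lsc_funP g)).

Lemma lsc_addA : associative lsc_add.
Proof. by move=> f g h; apply: val_inj; exact: addrA. Qed.
Lemma lsc_addC : commutative lsc_add.
Proof. by move=> f g; apply: val_inj; exact: addrC. Qed.
Lemma lsc_add0 : left_id (lsc_mk lsc0) lsc_add.
Proof. by move=> f; apply: val_inj; exact: add0r. Qed.
Lemma lsc_ge0 (f : lsc_type X) : lsc_mk lsc0 <= f.
Proof. exact: (@fct_ge0 X f). Qed.
Lemma lsc_leD (f g h k : lsc_type X) :
  f <= g -> h <= k -> lsc_add f h <= lsc_add g k.
Proof. exact: (@fct_leD X f g h k). Qed.

Definition lsc_po : poMonoid FunOrder.fun_display :=
  @POMonoid FunOrder.fun_display (lsc_type X) (lsc_mk lsc0) lsc_add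
    lsc_addA lsc_addC lsc_add0 lsc_ge0 lsc_leD.

Lemma lsc_leP (f g : lsc_po) : reflect (forall x, f x <= g x) (f <= g).
Proof. exact: (lefP (lsc_fun f) (lsc_fun g)). Qed.

Lemma lsc_supP (z : nat -> lsc_po) (s : lsc_po) :
  is_seq_sup z s <-> forall x, is_seq_sup (fun n => z n x) (s x).
Proof.
have sup_ptw (t : lsc_po) :
    (forall x, is_seq_sup (fun n => z n x) (t x)) -> is_seq_sup z t.
  move=> zt; split.
    by move=> _ [n _ <-]; apply/lsc_leP => x; apply: (zt x).1; exists n.
  move=> u ub; apply/lsc_leP => x; apply: (zt x).2 => _ [n _ <-].
  by have /lsc_leP : z n <= u by apply: ub; exists n.
split=> [zs x|]; last exact: sup_ptw.
have lz : lsc (fun y => enat_sup (fun n => z n y)).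
  by apply: lsc_sup => n; exact: lsc_funP.
have zt : is_seq_sup z (lsc_mk lz) by apply: sup_ptw => y; exact: enat_supP.
by rewrite (is_subset1_supremums zs zt); exact: enat_supP.
Qed.

Lemma lsc_O1 (z : nat -> lsc_po) :
  nondecreasing_seq z -> exists s, is_seq_sup z s.
Proof.
move=> _.
have lz : lsc (fun y => enat_sup (fun n => z n y)).
  by apply: lsc_sup => n; exact: lsc_funP.
by exists (lsc_mk lz); apply/lsc_supP => y; exact: enat_supP.
Qed.

Lemma lsc_O4 (u v : nat -> lsc_po) (s t : lsc_po) :
  nondecreasing_seq u -> nondecreasing_seq v ->
  is_seq_sup u s -> is_seq_sup v t ->
  is_seq_sup (fun n => po_add (u n) (v n)) (po_add s t).
Proof.
move=> uinc vinc /lsc_supP us /lsc_supP vt.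
apply/lsc_supP => x; apply: enat_supD => //.
  by move=> m n /uinc /lsc_leP.
by move=> m n /vinc /lsc_leP.
Qed.

Definition loc_const_fin (f : lsc_po) : Prop :=
  forall x, exists k, f x = Fin k /\ \forall y \near x, f y = Fin k.

Lemma loc_const_finD (f g : lsc_po) :
  loc_const_fin f -> loc_const_fin g -> loc_const_fin (po_add f g).
Proof.
move=> cf cg x; have [k [fk nfk]] := cf x; have [l [gl ngl]] := cg x.
exists (k + l)%N; split; first by rewrite -[LHS]/(f x + g x)%R fk gl.
near=> y; rewrite -[LHS]/(f y + g y)%R.
by rewrite (near nfk y)// (near ngl y).
Unshelve. all: by end_near. Qed.

Lemma loc_const_fin_compact (f : lsc_po) :
  compact [set: X] -> loc_const_fin f -> f \ll f.
Proof.
move=> /compact_near_coveringP cX cf z s zinc /lsc_supP zs /lsc_leP fs.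
have : \forall n \near \oo, [set: X] `<=` (fun x => f x <= z n x).
  apply: cX => x _; have [k [fk nfk]] := cf x.
  have [n kn] : exists n, Fin k <= z n x.
    by apply: (enat_sup_approx (zs x)); rewrite -fk.
  have /lscP nkn := @lsc_funP (z n).
  near=> y m => /=.
  rewrite (near nfk y)//; apply: (@le_trans _ _ (z n y)).
    by near: y; apply: nkn.
  have nm : (n <= m)%N by near: m; exact: nbhs_infty_ge.
  by have /lsc_leP := zinc _ _ nm.
move=> [N _ /(_ N (leqnn N)) fN]; exists N; apply/lsc_leP => x.
exact: fN.
Unshelve. all: by end_near. Qed.
End LscTheory.

Section CantorLsc.
Local Notation X := cantor_space.

Definition agree (n : nat) (x y : X) : Prop := forall i, (i < n)%N -> x i = y i.

Lemma nbhs_agree (x : X) (n : nat) : \forall y \near x, agree n x y.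
Proof.
elim: n => [|n IH]; first by apply: filterE => y i.
have xn : \forall y \near x, y n = x n.
  exact: (@proj_continuous nat (fun=> bool) n x _ (discrete_set1 (x n))).
near=> y => i; rewrite ltnS leq_eqVlt => /orP[/eqP ->|].
  by apply/esym; near: y.
by move: i; near: y.
Unshelve. all: by end_near. Qed.

Lemma nbhs_cylinder (x : X) (V : set X) :
  nbhs x V -> exists n, agree n x `<=` V.
Proof.
move=> xV; apply: contrapT => /forallNP nV.
have /choice[y yP] : forall n, exists y, agree n x y /\ ~ V y.
  by move=> n; have /existsNP[y /not_implyP[]] := nV n; exists y.
have yx : y @ \oo --> x.
  apply/cvg_sup.
  move=> i U [V'] [[W] oW <-] Wxi WU.
  apply: (filterS WU); rewrite nbhs_simpl; exists i.+1 => // n /= lin.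
  by rewrite -(yP n).1.
have [N _ /(_ N (leqnn N))] := yx _ xV.
by have [] := yP N.
Qed.

Definition cylinder_min (f : X -> enat) (n : nat) (x : X) : nat :=
  \max_(k < n.+1 | `[< forall y, agree n x y -> Fin k <= f y >]) k.

Lemma cylinder_min_ge (f : X -> enat) (n k : nat) (x : X) : (k <= n)%N ->
  (forall y, agree n x y -> Fin k <= f y) -> (k <= cylinder_min f n x)%N.
Proof.
move=> kn kf; rewrite -ltnS in kn.
rewrite /cylinder_min (bigD1 (Ordinal kn)) /=; last exact/asboolP.
exact: leq_maxl.
Qed.

Lemma cylinder_minP (f : X -> enat) (n : nat) (x : X) :
  (cylinder_min f n x <= n)%N /\
  forall y, agree n x y -> Fin (cylinder_min f n x) <= f y.
Proof.
apply: (big_ind (fun c => (c <= n)%N /\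
  forall y, agree n x y -> Fin c <= f y)).
- by split=> // y _; exact: enat_ge0.
- by move=> a b; rewrite /maxn; case: ifP.
- by move=> k /asboolP kf; split=> //; rewrite -ltnS.
Qed.

Lemma cylinder_min_agree (f : X -> enat) (n : nat) (x y : X) :
  agree n x y -> cylinder_min f n x = cylinder_min f n y.
Proof.
move=> xy; apply: eq_bigl => k; apply/asboolP/asboolP => kf z az;
  apply: kf => i lin; first by rewrite xy// az.
by rewrite -xy// az.
Qed.

Lemma cylinder_min_near (f : X -> enat) (n : nat) (x : X) :
  \forall y \near x, Fin (cylinder_min f n y) = Fin (cylinder_min f n x).
Proof.
by apply: filterS (nbhs_agree x n) => y xy; rewrite (cylinder_min_agree f xy).
Qed.

Lemma cylinder_min_lsc (f : X -> enat) (n : nat) :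
  lsc (fun x => Fin (cylinder_min f n x)).
Proof.
by move=> x a ax; apply: filterS (cylinder_min_near f n x) => y ->.
Qed.

Lemma lsc_cantor_compact (f : lsc_po X) : loc_const_fin f -> f \ll f.
Proof. exact/loc_const_fin_compact/cantor_space_compact. Qed.

Lemma lsc_cantor_approx (f : lsc_po X) : exists z : nat -> lsc_po X,
  [/\ nondecreasing_seq z, forall n, loc_const_fin (z n) & is_seq_sup z f].
Proof.
exists (fun n => lsc_mk (@cylinder_min_lsc f n)); split.
- move=> m n mn; apply/lsc_leP => x /=.
  have [cm cf] := cylinder_minP f m x.
  apply: cylinder_min_ge; first exact: leq_trans cm mn.
  by move=> y xy; apply: cf => i im; apply: xy; exact: leq_trans im mn.
- move=> n x; exists (cylinder_min f n x); split=> //.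
  exact: cylinder_min_near.
- apply/lsc_supP => x; split.
    by move=> _ [n _ <-] /=; apply: (cylinder_minP f n x).2.
  move=> t tb.
  have ft k : Fin k <= f x -> Fin k <= t.
    move=> kf; have /lscP lf := @lsc_funP X f.
    have [m mV] := nbhs_cylinder (lf _ _ kf).
    apply: (@le_trans _ _ (Fin (cylinder_min f (maxn k m) x))).
      apply: cylinder_min_ge; first exact: leq_maxl.
      by move=> y xy; apply: mV => i im; apply: xy; rewrite leq_max im orbT.
    by apply: tb; exists (maxn k m).
  case: (f x) ft => [k|] ft; first exact: ft.
  by case: t {tb} ft => // t /(_ t.+1 isT); rewrite /Order.le /= ltnn.
Qed.

Definition Lsc_cantor : cuSemigroup FunOrder.fun_display :=
  @CuSemigroup FunOrder.fun_display (lsc_po X) (@lsc_O1 X)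
    (algebraic_O2 lsc_cantor_compact lsc_cantor_approx)
    (algebraic_O3 lsc_cantor_compact (@loc_const_finD X) lsc_cantor_approx)
    (@lsc_O4 X).
End CantorLsc.

(* Main.v *)
(** A morphism of [K_cantor] from N^r to N^t is the pullback along a surjection
    from 'I_t onto 'I_r, and two of them agree as soon as they agree on the
    (compact) unit vectors, so the approximate condition in the definition of a
    Fraisse sequence is exact here. Hence any two Fraisse sequences are related
    by a commuting back-and-forth zigzag and have the same limit. The dyadic
    sequence ['I_(2 ^ n)], with reduction modulo powers of two, is a Fraisse
    sequence because its fibers are arbitrarily large, and its limit is
    [Lsc_cantor]: the locally constant finite functions on the Cantor space are
    those that depend only on finitely many bits. *)

From mathcomp Require Import all_boot all_order all_algebra.
From mathcomp Require Import all_classical all_analysis.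
From mathcomp Require Import zify.
Require Import Defs.

Set Implicit Arguments.
Unset Strict Implicit.
Unset Printing Implicit Defensive.

Import Order.TTheory GRing.Theory.

Local Open Scope classical_set_scope.
Local Open Scope ring_scope.
Local Open Scope order_scope.

(** * Suprema of sequences and the way-below relation *)

Section SeqSup.
Variables (d : Order.disp_t) (T : porderType d).
Implicit Types (z : nat -> T) (x y s t : T).

Lemma is_seq_sup_ub z s n : is_seq_sup z s -> z n <= s.
Proof. by move=> [zs _]; apply: zs; exists n. Qed.

Lemma is_seq_sup_lub z s t : is_seq_sup z s -> (forall n, z n <= t) -> s <= t.
Proof. by move=> [_ lub] zt; apply: lub => _ [n _ <-]. Qed.

Lemma is_seq_supI z s : (forall n, z n <= s) ->
  (forall t, (forall n, z n <= t) -> s <= t) -> is_seq_sup z s.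
Proof.
move=> zs lub; split; first by move=> _ [n _ <-].
by move=> t tb; apply: lub => n; apply: tb; exists n.
Qed.

Lemma is_seq_sup_unique z s t : is_seq_sup z s -> is_seq_sup z t -> s = t.
Proof. exact: is_subset1_supremums. Qed.

Lemma way_below_leW x y : x \ll y -> x <= y.
Proof.
move=> xy; have [] := xy (fun=> y) y; rewrite ?lexx//.
by apply: is_seq_supI => // t /(_ 0%N).
Qed.

Lemma way_below_seq_sup x y z : nondecreasing_seq z -> is_seq_sup z y ->
  x \ll y -> exists n, x <= z n.
Proof. by move=> zi zy xy; apply: xy zi zy (lexx _). Qed.

Lemma way_below_le_l x y t : x <= y -> y \ll t -> x \ll t.
Proof. by move=> xy yz; apply: way_below_le xy yz _. Qed.

Lemma way_below_le_r x y t : x \ll y -> y <= t -> x \ll t.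
Proof. by move=> xy yz; apply: way_below_le _ xy yz. Qed.
End SeqSup.

(** * A criterion for inductive limits in Cu *)

Section LimitCriterion.
Variables (d d' : Order.disp_t) (C : subcategory d) (S : inductive_sequence C).
Variables (L : cuSemigroup d') (lambda : forall i, seq_ob S i -> L).
Arguments lambda : clear implicits.
Hypothesis lambda_cocone : cu_cocone lambda.
Hypothesis lambda_le : forall i x y, lambda i x <= lambda i y -> x <= y.
Hypothesis lambda_approx : forall x : L, exists w : forall n, seq_ob S n,
  (forall n, seq_map S n n.+1 (w n) \ll w n.+1) /\
  is_seq_sup (fun n => lambda n (w n)) x.

Let w x := projT1 (cid (lambda_approx x)).

Let w_way_below x n : seq_map S n n.+1 (w x n) \ll w x n.+1.
Proof. by rewrite /w; case: cid => /= ? []. Qed.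

Let w_sup x : is_seq_sup (fun n => lambda n (w x n)) x.
Proof. by rewrite /w; case: cid => /= ? []. Qed.

Let cocone_inc e (T : cuSemigroup e) (tau : forall i, seq_ob S i -> T) x :
  cu_cocone tau -> nondecreasing_seq (fun n => tau n (w x n)).
Proof.
move=> [tau_mor tauE]; apply/nondecreasing_seqP => n.
rewrite -(tauE n n.+1)//=.
exact: (cu_mor_le (tau_mor _) (way_below_leW (@w_way_below x n))).
Qed.

Section Universal.
Variables (e : Order.disp_t) (T : cuSemigroup e).
Variables (tau : forall i, seq_ob S i -> T).
Arguments tau : clear implicits.
Hypothesis tau_cocone : cu_cocone tau.

Let tau_mor i : cu_morphism (tau i). Proof. exact: tau_cocone.1. Qed.
Let tauE i j a : (i <= j)%N -> tau j (seq_map S i j a) = tau i a.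
Proof. by move=> ij; exact: (tau_cocone.2 i j ij). Qed.
Let lambda_mor i : cu_morphism (lambda i). Proof. exact: lambda_cocone.1. Qed.
Let lambdaE i j a : (i <= j)%N -> lambda j (seq_map S i j a) = lambda i a.
Proof. by move=> ij; exact: (lambda_cocone.2 i j ij). Qed.

(** Both elements move to the common stage [maxn m n], where [lambda] reflects the order. *)
Lemma lambda_le_tau m n a b : lambda m a <= lambda n b -> tau m a <= tau n b.
Proof.
have mk := leq_maxl m n; have nk := leq_maxr m n.
rewrite -(lambdaE a mk) -(lambdaE b nk) -(tauE a mk) -(tauE b nk).
by move/lambda_le/(cu_mor_le (tau_mor _)).
Qed.

(** The only candidate: a morphism extending [tau] preserves the supremum [x] of the
    [lambda n (w x n)]. *)
Let u x := projT1 (cid (cu_O1 (cocone_inc x tau_cocone))).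

Let uP x : is_seq_sup (fun n => tau n (w x n)) (u x).
Proof. by rewrite /u; case: cid. Qed.

(** [lambda m a] is way below [x], hence below some [lambda n (w x n)], and this inequality passes
    to [tau]. It makes [u] monotone although the sequences [w x] are arbitrary choices. *)
Let tau_le_u m a b x : a \ll b -> lambda m b <= x -> tau m a <= u x.
Proof.
move=> ab bx.
have /(cu_mor_way_below (lambda_mor m)) lab := ab.
have [n an] := way_below_seq_sup (cocone_inc x lambda_cocone) (w_sup x)
  (way_below_le_r lab bx).
exact: le_trans (lambda_le_tau an) (is_seq_sup_ub n (uP x)).
Qed.

Let u_le x y : x <= y -> u x <= u y.
Proof.
move=> xy; apply: (is_seq_sup_lub (uP x)) => n.
rewrite -(tauE _ (leqnSn n)); apply: tau_le_u (@w_way_below x n) _.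
exact: le_trans (is_seq_sup_ub _ (w_sup x)) xy.
Qed.

Let u_lambda m a : u (lambda m a) = tau m a.
Proof.
apply/eqP; rewrite eq_le; apply/andP; split.
  apply: (is_seq_sup_lub (uP _)) => n; apply: lambda_le_tau.
  exact: (is_seq_sup_ub n (w_sup (lambda m a))).
have [z [zwb za]] := cu_O2 a.
have zinc : nondecreasing_seq z.
  by apply/nondecreasing_seqP => n; exact: way_below_leW.
apply: (is_seq_sup_lub (cu_mor_sup (tau_mor m) zinc za)) => n /=.
apply: tau_le_u (zwb n) _.
exact/(cu_mor_le (lambda_mor m))/is_seq_sup_ub.
Qed.

Let u_sup z s : nondecreasing_seq z -> is_seq_sup z s -> is_seq_sup (u \o z) (u s).
Proof.
move=> zinc zs; apply: is_seq_supI => [n|t zt]; first exact/u_le/is_seq_sup_ub.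
apply: (is_seq_sup_lub (uP s)) => n; rewrite -(tauE _ (leqnSn n)) -u_lambda.
have wb := cu_mor_way_below (lambda_mor n.+1) (@w_way_below s n).
have [k nk] := way_below_seq_sup zinc zs
  (way_below_le_r wb (is_seq_sup_ub n.+1 (w_sup s))).
exact: le_trans (u_le nk) (zt k).
Qed.

Let u_morphism : cu_morphism u.
Proof.
split=> //.
- by rewrite -(cu_mor0 (lambda_mor 0%N)) u_lambda (cu_mor0 (tau_mor 0%N)).
- move=> x y.
  have inc a := cocone_inc a lambda_cocone.
  (* By (O4) the stagewise sums have supremum [po_add x y]; [u] preserves it and is [tau] on each
     stage. *)
  have xy := cu_O4 (inc x) (inc y) (w_sup x) (w_sup y).
  have /u_sup /(_ xy) uxy : nondecreasing_seq
      (fun n => po_add (lambda n (w x n)) (lambda n (w y n))).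
    by move=> m n mn; apply: po_leD; exact: inc.
  apply: is_seq_sup_unique uxy _.
  have -> : u \o (fun n => po_add (lambda n (w x n)) (lambda n (w y n))) =
      (fun n => po_add (tau n (w x n)) (tau n (w y n))).
    by apply/funext => n /=; rewrite -!(cu_morD (lambda_mor n)) u_lambda
      (cu_morD (tau_mor n)).
  exact: (cu_O4 (cocone_inc _ tau_cocone) (cocone_inc _ tau_cocone)).
- move=> x y xy.
  (* [x] lies below one stage of the sequence of [y]; the passage to the next stage supplies the
     way-below relation. *)
  have [n xn] := way_below_seq_sup (cocone_inc y lambda_cocone) (w_sup y) xy.
  apply: (way_below_le_l (u_le xn)); rewrite u_lambda -(tauE _ (leqnSn n)).
  apply: way_below_le_r (cu_mor_way_below (tau_mor _) (@w_way_below y n)) _.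
  exact: is_seq_sup_ub n.+1 (uP y).
Qed.

Lemma cu_limit_criterion_universal : exists u : L -> T,
  [/\ cu_morphism u, forall i, u \o lambda i =1 tau i &
      forall v : L -> T, cu_morphism v ->
        (forall i, v \o lambda i =1 tau i) -> v =1 u].
Proof.
exists u; split=> // v vm vE x; apply: is_seq_sup_unique (uP x).
have := cu_mor_sup vm (cocone_inc x lambda_cocone) (w_sup x).
by congr (is_seq_sup _ _); apply/funext => n; exact: vE.
Qed.
End Universal.

Lemma cu_limit_criterion : cu_limit lambda.
Proof. by split=> // e T tau; exact: cu_limit_criterion_universal. Qed.
End LimitCriterion.

(** * Exact Fraïssé sequences and back-and-forth *)

(** The inequality [i < j] is strict so that the indices of the zigzag are cofinal. *)
Definition exact_fraisse (d : Order.disp_t) (C : subcategory d)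
    (S : inductive_sequence C) : Prop :=
  forall (i : nat) (c : C) (alpha : seq_ob S i -> sub_ob c), sub_hom alpha ->
  exists2 j : nat, (i < j)%N &
  exists2 beta : sub_ob c -> seq_ob S j, sub_hom beta &
    beta \o alpha =1 seq_map S i j.

Section Transfer.
Variables (d : Order.disp_t) (C : subcategory d).

(** Stage [m] enters the ladder at rung [m], as [m <= n m] allows; the commuting squares make the
    result independent of the rung. *)
Lemma pull_cocone (A B : inductive_sequence C) (n i : nat -> nat)
    (gamma : forall k, seq_ob A (n k) -> seq_ob B (i k)) :
  {homo n : k l / (k <= l)%N} -> {homo i : k l / (k <= l)%N} ->
  (forall k, (k <= n k)%N) ->
  (forall k, sub_hom (gamma k)) ->
  (forall k, gamma k.+1 \o seq_map A (n k) (n k.+1) =1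
             seq_map B (i k) (i k.+1) \o gamma k) ->
  forall (e : Order.disp_t) (T : cuSemigroup e) (tau : forall j, seq_ob B j -> T),
  cu_cocone tau ->
  exists2 tau' : forall m, seq_ob A m -> T, cu_cocone tau' &
    forall k, tau' (n k) =1 tau (i k) \o gamma k.
Proof.
move=> ninc iinc nge ghom gE e T tau [tau_mor tauE].
have stab k l a : (k <= l)%N ->
    tau (i l) (gamma l (seq_map A (n k) (n l) a)) = tau (i k) (gamma k a).
  move=> /subnK <-; elim: (l - k)%N => [|p IH] /=; first by rewrite seq_map_id.
  rewrite addSn -(@seq_map_comp _ _ A _ (n (p + k)%N)).
  - rewrite -[gamma _ _]/((gamma (p + k).+1 \o
      seq_map A (n (p + k)%N) (n (p + k).+1)) _) gE /= -IH.
    by rewrite -(tauE (i (p + k)%N) (i (p + k).+1))//; exact/iinc.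
  - exact/ninc/leq_addl.
  - exact/ninc.
pose tau' m (a : seq_ob A m) := tau (i m) (gamma m (seq_map A m (n m) a)).
have tau'E k m (a : seq_ob A m) : (m <= k)%N ->
    tau' m a = tau (i k) (gamma k (seq_map A m (n k) a)).
  move=> mk; rewrite /tau' -(stab _ _ _ mk).
  by rewrite -(@seq_map_comp _ _ A m (n m) (n k))//; exact/ninc.
exists tau'.
  split=> [m|m l ml a].
    apply: (cu_morphism_comp _ (tau_mor _)).
    apply: (cu_morphism_comp _ (sub_hom_cu (ghom _))).
    exact/sub_hom_cu/seq_map_hom.
  rewrite /= (tau'E l m)// /tau'.
  by rewrite -(@seq_map_comp _ _ A m l (n l)).
move=> k a; rewrite /tau'; have := stab k (n k) a (nge k).
by rewrite /=.
Qed.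

Variables (A B : inductive_sequence C).

(** A stage of the back-and-forth: an arrow from [B] to [A] bundled with its indices, so that
    dependent choice can iterate the step. *)
Let state := {n : nat & {i : nat &
  {alpha : seq_ob B i -> seq_ob A n | sub_hom alpha}}}.
Let stn (s : state) := tag s.
Let sti (s : state) := tag (tagged s).
Let sta (s : state) : seq_ob B (sti s) -> seq_ob A (stn s) :=
  sval (tagged (tagged s)).

Let step_rel (s s' : state) (beta : seq_ob A (stn s) -> seq_ob B (sti s')) :=
  [/\ sub_hom beta, beta \o @sta s =1 seq_map B (sti s) (sti s')
    & @sta s' \o beta =1 seq_map A (stn s) (stn s')].

(** The limit cocone on [A] is pulled back to [B] along the [alpha k]. Conversely, a cocone on [B]
    is pulled back to [A] along the [beta k], where the universal property of [L] applies. *)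
Lemma transfer_limit : exact_fraisse A -> exact_fraisse B ->
  (exists n, exists alpha : seq_ob B 0 -> seq_ob A n, sub_hom alpha) ->
  forall (e : Order.disp_t) (L : cuSemigroup e) (lambda : forall n, seq_ob A n -> L),
  cu_limit lambda ->
  exists lambda' : forall i, seq_ob B i -> L, cu_limit lambda'.
Proof.
move=> exA exB [n0 [alpha0 alpha0_hom]] e L lambda [lambda_cocone lambda_univ].
have step (s : state) : {s' : state |
    [/\ (stn s < stn s')%N, (sti s < sti s')%N & exists beta, @step_rel s s' beta]}.
  apply: cid; case: s => n [i [alpha alpha_hom]].
  have [j ij [beta beta_hom betaE]] := exB _ _ _ alpha_hom.
  have [m nm [alpha' alpha'_hom alpha'E]] := exA _ _ _ beta_hom.
  exists (existT _ m (existT _ j (exist _ alpha' alpha'_hom))).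
  by split=> //; exists beta.
have [st [_ stP]] := dependent_choice step
  (existT _ n0 (existT _ 0%N (exist _ alpha0 alpha0_hom))).
pose n k := stn (st k); pose i k := sti (st k).
pose alpha k : seq_ob B (i k) -> seq_ob A (n k) := @sta (st k).
have alpha_hom k : sub_hom (alpha k) by exact: (svalP (tagged (tagged (st k)))).
have betaex k : exists beta, @step_rel (st k) (st k.+1) beta by have [] := stP k.
pose beta k : seq_ob A (n k) -> seq_ob B (i k.+1) := projT1 (cid (betaex k)).
have betaP k : @step_rel (st k) (st k.+1) (beta k) by rewrite /beta; case: cid.
have beta_hom k : sub_hom (beta k) by have [] := betaP k.
have ba k : beta k \o alpha k =1 seq_map B (i k) (i k.+1) by have [] := betaP k.
have ab k : alpha k.+1 \o beta k =1 seq_map A (n k) (n k.+1) by have [] := betaP k.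
have nlt k : (n k < n k.+1)%N by have [] := stP k.
have ilt k : (i k < i k.+1)%N by have [] := stP k.
have mono (f : nat -> nat) : (forall k, (f k < f k.+1)%N) ->
    {homo f : k l / (k <= l)%N} /\ forall k, (k <= f k)%N.
  move=> flt; split.
    by apply: homo_leq => // [y x z|k]; [exact: leq_trans|exact: ltnW].
  by elim=> // k IH; exact: leq_ltn_trans IH (flt k).
have [ninc nge] := mono _ nlt; have [iinc ige] := mono _ ilt.
have [lambda' lambda'_cocone lambda'E] : exists2 lambda' : forall m, seq_ob B m -> L,
    cu_cocone lambda' & forall k, lambda' (i k) =1 lambda (n k) \o alpha k.
  apply: pull_cocone => //.
  (* Both sides of the square become [alpha k.+1] after [beta k] after [alpha k]. *)
  by move=> k a /=; rewrite -[seq_map B _ _ a]ba -[seq_map A _ _ (alpha k a)]ab.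
exists lambda'; split=> // e' T tau tau_cocone.
have [tau' tau'_cocone tau'E] : exists2 tau' : forall m, seq_ob A m -> T,
    cu_cocone tau' & forall k, tau' (n k) =1 tau (i k.+1) \o beta k.
  (* The shift of index appears because [beta k] lands in stage [i k.+1]. *)
  apply: (@pull_cocone A B n (fun k => i k.+1)) => //.
    by move=> k l kl; exact: iinc.
  by move=> k a /=; rewrite -[seq_map B _ _ (beta k a)]ba -[seq_map A _ _ a]ab.
have [u [um uE uU]] := lambda_univ _ _ _ tau'_cocone.
exists u; split=> // [m a|v vm vE].
  rewrite /= -(lambda'_cocone.2 m (i m) (ige m)) /= lambda'E /=.
  rewrite -[u _]/((u \o lambda (n m)) _) uE tau'E /=.
  rewrite -[beta m _]/((beta m \o alpha m) _) ba.
  rewrite -(tau_cocone.2 m (i m.+1) (leq_trans (ige m) (ltnW (ilt m)))) /=.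
  by rewrite -[RHS]/(tau _ _) -(@seq_map_comp _ _ B m (i m) (i m.+1))//; exact/ltnW.
apply: uU => // m a /=.
(* Pushing [a] to stage [n m.+1] through [beta m] exposes [lambda] composed with [alpha m.+1], which
   is [lambda']. *)
rewrite -(tau'_cocone.2 m (n m) (nge m)) /= tau'E /=.
rewrite -(lambda_cocone.2 m (n m) (nge m)) /=.
rewrite -(lambda_cocone.2 (n m) (n m.+1) (ltnW (nlt m))) /=.
rewrite -[seq_map A (n m) (n m.+1) _]ab /=.
rewrite -[lambda _ _]/((lambda (n m.+1) \o alpha m.+1) _).
by rewrite -lambda'E; exact: vE.
Qed.
End Transfer.

(** * Morphisms out of simplicial Cu-semigroups *)

Section SimplicialMorphisms.
Variable r : nat.

Lemma simplicial_Fin_compact (a : 'I_r -> nat) :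
  ((fun i => Fin (a i)) : simplicial r) \ll (fun i => Fin (a i)).
Proof. by apply: simplicial_compact => i; exists (a i). Qed.

Lemma simplicial_Fin_approx (f : simplicial r) : exists a : nat -> 'I_r -> nat,
  nondecreasing_seq (fun n i => Fin (a n i) : enat) /\
  is_seq_sup (fun n => (fun i => Fin (a n i)) : simplicial r) f.
Proof.
have [z [zinc zfin zf]] := simplicial_approx f.
have /choice[a aE] : forall n, exists b : 'I_r -> nat, z n = fun i => Fin (b i).
  by move=> n; have /choice[b bE] := zfin n; exists b; exact/funext.
have zE : z = fun n i => Fin (a n i) by apply/funext => n; rewrite aE.
by exists a; rewrite -zE.
Qed.

Lemma simplicial_countably_based : countably_based (simplicial r).
Proof.
(* Finite functions are used because they form a countable type. *)
exists (range (fun g : {ffun 'I_r -> nat} => (fun i => Fin (g i)) : simplicial r)).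
split; first exact: sub_countable (card_image_le _ _) (countableP _).
move=> f; have [a [ainc af]] := simplicial_Fin_approx f.
exists (fun n i => Fin (a n i)); split=> // n.
  by exists [ffun i => a n i] => //; apply/funext => i; rewrite ffunE.
apply: way_below_le_r (@simplicial_Fin_compact (a n)) _.
by apply: ainc.
Qed.

Definition simplicial_unit (i : 'I_r) : simplicial r := fun j => Fin (i == j).

Lemma simplicial_unit_compact i : simplicial_unit i \ll simplicial_unit i.
Proof. exact: simplicial_Fin_compact. Qed.

Lemma Fin_sum (I : Type) (s : seq I) (P : pred I) (F : I -> nat) :
  (\sum_(i <- s | P i) Fin (F i))%R = Fin (\sum_(i <- s | P i) F i)%N.
Proof. by rewrite (big_morph Fin (id1 := Fin 0) (op1 := enat_add)). Qed.

Lemma simplicial_bigE (I : Type) (s : seq I) (P : pred I)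
    (F : I -> simplicial r) (j : 'I_r) :
  (\big[po_add/po_zero]_(i <- s | P i) F i) j = (\sum_(i <- s | P i) F i j)%R.
Proof. by apply: (big_morph (fun f : simplicial r => f j)). Qed.

Lemma simplicial_Fin_sum (a : 'I_r -> nat) : ((fun i => Fin (a i)) : simplicial r) =
  \big[po_add/po_zero]_i \big[po_add/po_zero]_(k < a i) simplicial_unit i.
Proof.
apply/funext => j; rewrite simplicial_bigE.
under eq_bigr do rewrite simplicial_bigE Fin_sum sum_nat_const card_ord.
rewrite Fin_sum (bigD1 j)//= eqxx muln1 big1 ?addn0// => i ij.
by rewrite (negbTE ij) muln0.
Qed.

Lemma cu_morphism_big (d d' : Order.disp_t) (S : cuSemigroup d)
    (T : cuSemigroup d') (f : S -> T) (I : Type) (s : seq I) (P : pred I)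
    (F : I -> S) : cu_morphism f ->
  f (\big[po_add/po_zero]_(i <- s | P i) F i) =
  \big[po_add/po_zero]_(i <- s | P i) f (F i).
Proof. by move=> fm; apply: big_morph; [exact: cu_morD|exact: cu_mor0]. Qed.

(** The unit vectors generate the finite vectors additively, and every element is a supremum of
    finite vectors. *)
Lemma simplicial_morphism_ext (d : Order.disp_t) (T : cuSemigroup d)
    (f g : simplicial r -> T) : cu_morphism f -> cu_morphism g ->
  (forall i, f (simplicial_unit i) = g (simplicial_unit i)) -> f =1 g.
Proof.
move=> fm gm fg x; have [a [ainc ax]] := simplicial_Fin_approx x.
apply: is_seq_sup_unique (cu_mor_sup fm ainc ax) _.
pose z n : simplicial r := fun i => Fin (a n i).
have -> : f \o z = g \o z.
  apply/funext => n; rewrite /z /= simplicial_Fin_sum !cu_morphism_big//.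
  by apply: eq_bigr => i _; rewrite !cu_morphism_big//; apply: eq_bigr.
exact: cu_mor_sup.
Qed.

(** If [x] is way below [y], a finite vector lies between them, so compactness of the images of
    finite vectors gives preservation of the way-below relation. *)
Lemma simplicial_cu_morphism (d : Order.disp_t) (T : cuSemigroup d)
    (f : simplicial r -> T) :
  f po_zero = po_zero -> (forall x y, f (po_add x y) = po_add (f x) (f y)) ->
  (forall x y, x <= y -> f x <= f y) ->
  (forall z s, nondecreasing_seq z -> is_seq_sup z s ->
    is_seq_sup (f \o z) (f s)) ->
  (forall a : 'I_r -> nat, f (fun i => Fin (a i)) \ll f (fun i => Fin (a i))) ->
  cu_morphism f.
Proof.
move=> f0 fD fle fsup fc; split=> // x y xy.
have [a [ainc ay]] := simplicial_Fin_approx y.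
have [n xn] := way_below_seq_sup ainc ay xy.
apply: (way_below_le (fle _ _ xn) (fc (a n))).
exact/fle/(is_seq_sup_ub n ay).
Qed.
End SimplicialMorphisms.

(** * Morphisms of [K_cantor] as pullbacks along surjections *)

Section Pullback.
Variables (r t : nat) (phi : 'I_t -> 'I_r).

Definition simplicial_pull (f : simplicial r) : simplicial t := f \o phi.

Lemma simplicial_pull_unit i :
  simplicial_pull (simplicial_unit i) = fun y => Fin (i == phi y).
Proof. by []. Qed.

Lemma simplicial_pull_morphism : cu_morphism simplicial_pull.
Proof.
apply: simplicial_cu_morphism => //.
- by move=> x y /lefP xy; apply/lefP => i; exact: xy.
- move=> z s _ /simplicial_supP zs; apply/simplicial_supP => i; exact: zs.
- by move=> a; exact: (@simplicial_Fin_compact _ (a \o phi)).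
Qed.

Lemma simplicial_pull_embedding : (forall i, exists y, phi y = i) ->
  order_embedding simplicial_pull.
Proof.
move=> phi_surj; split; first exact: simplicial_pull_morphism.
move=> f g /lefP fg; apply/lefP => i; have [y <-] := phi_surj i; exact: fg.
Qed.
End Pullback.

Lemma simplicial_pull_hom (r t : K_cantor) (phi : 'I_(val t) -> 'I_(val r)) :
  (forall i, exists y, phi y = i) -> @sub_hom _ K_cantor r t (simplicial_pull phi).
Proof. by move=> phi_surj; split=> //; exact: simplicial_pull_embedding. Qed.

Lemma enat_addr_eq1 (x y : enat) : x != 0%R -> (x + y)%R = Fin 1 ->
  x = Fin 1 /\ y = 0%R.
Proof.
case: x y => [x|] [y|]// x0 [xy].
have {}x0 : x != 0%N by apply: contra x0 => /eqP ->.
suff [-> ->] : x = 1%N /\ y = 0%N by [].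
lia.
Qed.

Lemma enat_psumr_eq0 (I : finType) (P : pred I) (F : I -> enat) :
  (\sum_(i | P i) F i)%R = 0%R -> forall i, P i -> F i = 0%R.
Proof.
move=> + i Pi; rewrite (bigD1 i)//=.
by move: (bigop _ _ _) => y; case: (F i) y => [[|k]|] // [].
Qed.

(** Since the unit vectors add up to the constant 1, which [alpha] preserves, at each coordinate [y]
    exactly one of them has an image with value 1 there, the others giving 0; its index is
    [phi y]. *)
Lemma K_cantor_homP (r t : K_cantor) (alpha : sub_ob r -> sub_ob t) :
  sub_hom alpha ->
  exists2 phi : 'I_(val t) -> 'I_(val r), (forall i, exists y, phi y = i) &
    alpha =1 simplicial_pull phi.
Proof.
move=> [[am ale] a1].
have phiex y : exists i, forall j,
    alpha (simplicial_unit j) y = Fin (j == i).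
  have sum1 : (\sum_i alpha (simplicial_unit i) y)%R = Fin 1.
    have <- := @simplicial_bigE (val t) _ (index_enum _) xpredT
      (fun i => alpha (simplicial_unit i)) y.
    rewrite -(cu_morphism_big _ _ _ am).
    have := congr1 (fun f : simplicial _ => f y) a1; rewrite /simplicial1 => <-.
    congr (alpha _ y).
    rewrite -[RHS]/((fun i => Fin ((fun=> 1%N) i)) : simplicial _).
    rewrite simplicial_Fin_sum; apply: eq_bigr => i _.
    rewrite big_ord_recl big_ord0 po_addC po_add0//.
  have [i i0] : exists i, alpha (simplicial_unit i) y != 0%R.
    apply: contrapT => /forallNP a0; move: sum1; rewrite big1// => i _.
    by apply/eqP; apply: contrapT => /negP; exact: a0.
  move: sum1; rewrite (bigD1 i)//= => /(enat_addr_eq1 i0)[ai /enat_psumr_eq0 a0].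
  exists i => j; case: eqVneq => [->//|ji]; exact: a0.
have [phi phiE] := choice phiex.
have phi_pull i :
    alpha (simplicial_unit i) = simplicial_pull phi (simplicial_unit i).
  by apply/funext => y; rewrite phiE.
exists phi.
  (* If [i] were missed, the unit vector at [i] would be sent to zero, against order reflection. *)
  move=> i; apply: contrapT => /forallNP ni.
  have /ale/lefP/(_ i) : alpha (simplicial_unit i) <= alpha po_zero.
    rewrite phi_pull (cu_mor0 am); apply/lefP => y.
    by rewrite simplicial_pull_unit; case: eqP => // iy; case: (ni y).
  by rewrite /simplicial_unit eqxx.
exact: simplicial_morphism_ext am (simplicial_pull_morphism _) phi_pull.
Qed.

(** Unit vectors are compact, so each may be compared with itself in [approx_on]: the two
    inequalities become an equality on generators. *)
Lemma K_cantor_exact_fraisse (S : inductive_sequence K_cantor) :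
  fraisse_sequence S -> exact_fraisse S.
Proof.
move=> [_ Sfr] i c alpha ahom.
have [|j ij [beta bhom bE]] := Sfr i (range (@simplicial_unit _)) _ c alpha ahom.
  by apply: finite_image; exact: finite_finset.
(* One further stage turns [i <= j] into a strict inequality. *)
exists j.+1 => //; exists (seq_map S j j.+1 \o beta).
  exact: sub_hom_comp bhom (seq_map_hom S (leqnSn j)).
move=> x; rewrite -(@seq_map_comp _ _ S i j j.+1)//=; congr (seq_map S j j.+1 _).
apply: (simplicial_morphism_ext (f := beta \o alpha)).
- exact: cu_morphism_comp (sub_hom_cu ahom) (sub_hom_cu bhom).
- exact: sub_hom_cu (seq_map_hom S ij).
move=> k; have [|||le1 le2] := bE (simplicial_unit k) (simplicial_unit k).
- by exists k.
- by exists k.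
- exact: simplicial_unit_compact.
by apply/eqP; rewrite eq_le le1.
Qed.

(** * The dyadic Fraïssé sequence *)

Lemma dyadic_gt0 n : (0 < 2 ^ n)%N. Proof. by rewrite expn_gt0. Qed.

(** Truncation to the [i] low bits, the finite counterpart of restricting a point of the Cantor
    space to its first [i] coordinates. *)
Definition dyadic_res i j (k : 'I_(2 ^ j)) : 'I_(2 ^ i) :=
  Ordinal (ltn_pmod k (dyadic_gt0 i)).

Lemma dyadic_res_surj i j : (i <= j)%N ->
  forall k : 'I_(2 ^ i), exists l : 'I_(2 ^ j), dyadic_res i l = k.
Proof.
move=> ij k; have kj : (k < 2 ^ j)%N.
  by apply: leq_trans (ltn_ord k) _; rewrite leq_exp2l.
by exists (Ordinal kj); apply/val_inj; rewrite /= modn_small.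
Qed.

Definition dyadic_idx (n : nat) : K_cantor := exist _ (2 ^ n)%N (dyadic_gt0 n).

Definition dyadic_map i j : sub_ob (dyadic_idx i) -> sub_ob (dyadic_idx j) :=
  simplicial_pull (@dyadic_res i j).

Lemma dyadic_map_hom i j : (i <= j)%N -> sub_hom (@dyadic_map i j).
Proof. by move=> ij; apply: simplicial_pull_hom; exact: dyadic_res_surj. Qed.

Lemma dyadic_map_id i : @dyadic_map i i =1 id.
Proof.
move=> f; apply/funext => k; congr (f _); apply/val_inj.
by rewrite /= modn_small.
Qed.

Lemma dyadic_map_comp i j k : (i <= j)%N -> (j <= k)%N ->
  @dyadic_map j k \o @dyadic_map i j =1 @dyadic_map i k.
Proof.
move=> ij _ f; apply/funext => l; congr (f _); apply/val_inj => /=.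
by rewrite modn_dvdm// dvdn_exp2l.
Qed.

Definition dyadic : inductive_sequence K_cantor :=
  InductiveSequence dyadic_map_hom dyadic_map_id dyadic_map_comp.

(* A number below [2 ^ (i + c)] consists of [i] low bits and [c] high bits: the
   high bits are used to enumerate the fibers of [phi]. *)
Lemma dyadic_lift i c (phi : 'I_c -> 'I_(2 ^ i)) :
  (forall k, exists y, phi y = k) ->
  exists2 psi : 'I_(2 ^ (i + c)) -> 'I_c, (forall y, exists k, psi k = y) &
    forall k, phi (psi k) = dyadic_res i k.
Proof.
move=> /choice[sec secK].
(* The high bits propose an element of ['I_c]; a proposal outside the fiber over the low bits is
   replaced by the value of the section. *)
pose psi (k : 'I_(2 ^ (i + c))) : 'I_c :=
  if insub (k %/ 2 ^ i)%N is Some y then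
    if phi y == dyadic_res i k then y else sec (dyadic_res i k)
  else sec (dyadic_res i k).
exists psi => [y|k]; last by rewrite /psi; case: insubP => [y _ _|_] //; case: eqP.
(* The preimage of [y] has high part [y] and low part [phi y]; it fits in [i + c] bits because
   [c < 2 ^ c]. *)
have klt : (y * 2 ^ i + phi y < 2 ^ (i + c))%N.
  rewrite expnD mulnC; apply: (@leq_trans (2 ^ i * y.+1)%N).
    by rewrite mulnS addnC ltn_add2r.
  by rewrite leq_mul2l (leq_trans (ltn_ord y)) ?orbT// ltnW// ltn_expl.
exists (Ordinal klt); rewrite /psi /= divnMDl ?dyadic_gt0// divn_small// addn0 valK.
case: eqP => // -[]; apply/val_inj.
by rewrite /= modnMDl modn_small.
Qed.

Lemma dyadic_fraisse : fraisse_sequence dyadic.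
Proof.
split=> [i|i F _ c alpha ahom]; first exact: simplicial_countably_based.
have [phi phi_surj phiE] := K_cantor_homP ahom.
have [psi psi_surj psiE] := dyadic_lift phi_surj.
exists (i + val c)%N; first exact: leq_addr.
exists (@simplicial_pull _ (2 ^ (i + val c)) psi).
  exact: (@simplicial_pull_hom c (dyadic_idx (i + val c))).
have E x : simplicial_pull psi (alpha x) = seq_map dyadic i (i + val c) x.
  by rewrite phiE; apply/funext => k; rewrite /simplicial_pull /= psiE.
(* The triangle commutes exactly, so both inequalities reduce to monotonicity. *)
move=> x' x _ _ /way_below_leW x'x; rewrite /= !E.
by have := cu_mor_le (sub_hom_cu (seq_map_hom dyadic (leq_addr (val c) i))) x'x.
Qed.

(** * Binary coding of finite prefixes in the Cantor space *)

Section Code.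
Implicit Type x : cantor_space.

(** Least significant bit first, so that restriction of prefixes is reduction modulo a power of
    two. *)
Fixpoint code (n : nat) x : nat :=
  if n is m.+1 then (code m x + x m * 2 ^ m)%N else 0%N.

Definition decode (k : nat) : cantor_space := fun i => odd (k %/ 2 ^ i).

Lemma code_lt n x : (code n x < 2 ^ n)%N.
Proof. by elim: n => //= n IH; rewrite expnS; case: (x n); lia. Qed.

Lemma code_modn i j x : (i <= j)%N -> (code j x %% 2 ^ i)%N = code i x.
Proof.
move=> /subnK <-; elim: (j - i)%N => [|p IH]; first by rewrite modn_small ?code_lt.
rewrite addSn /= -modnDmr.
by rewrite expnD mulnA modnMl addn0.
Qed.

Lemma code_decode n k : code n (decode k) = (k %% 2 ^ n)%N.
Proof.
elim: n => [|n IH] /=; first by rewrite modn1.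
rewrite IH /decode -modn2 expnSr.
(* [k] is split into the bits above position [n], the bit at [n] and the [n] low bits. *)
have kE : k =
    (k %/ 2 ^ n %/ 2 * (2 ^ n * 2) + (k %% 2 ^ n + k %/ 2 ^ n %% 2 * 2 ^ n))%N.
  rewrite {1}(divn_eq k (2 ^ n)%N) {1}(divn_eq (k %/ 2 ^ n)%N 2); lia.
rewrite [in RHS]kE modnMDl [RHS]modn_small//.
have := ltn_pmod k (dyadic_gt0 n); have := ltn_pmod (k %/ 2 ^ n) (isT : 0 < 2)%N.
move: (2 ^ n)%N (k %/ 2 ^ n %% 2)%N (k %% 2 ^ n)%N => p b l.
case: b => [|[|]]//; lia.
Qed.

Lemma code_agree n x y : agree n x y -> code n x = code n y.
Proof.
elim: n => //= n IH xy; rewrite IH ?xy// => i lin; apply: xy.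
exact: ltnW.
Qed.

Lemma agree_decode n x : agree n x (decode (code n x)).
Proof.
(* Modulo [2 ^ i.+1] the code is [code i x + x i * 2 ^ i]; after division by [2 ^ i] the higher bits
   contribute an even number, so the parity is [x i]. *)
move=> i lin; rewrite /decode (divn_eq (code n x) (2 ^ i.+1)%N) code_modn//=.
rewrite expnS mulnA addnCA -mulnDl divnDr ?dvdn_mull//.
rewrite mulnK ?dyadic_gt0// divn_small ?code_lt// add0n oddD oddM andbF /=.
by case: (x i).
Qed.

Definition code_ord n x : 'I_(2 ^ n) := Ordinal (code_lt n x).

Lemma code_ord_decode n (k : 'I_(2 ^ n)) : code_ord n (decode k) = k.
Proof. by apply/val_inj; rewrite /= code_decode modn_small. Qed.

Lemma dyadic_res_code i j x : (i <= j)%N ->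
  dyadic_res i (code_ord j x) = code_ord i x.
Proof. by move=> ij; apply/val_inj; exact: code_modn. Qed.

Lemma code_ord_near n x : \forall y \near x, code_ord n y = code_ord n x.
Proof.
by apply: filterS (nbhs_agree x n) => y /code_agree xy; exact/val_inj/esym.
Qed.

Lemma code_lsc n (f : 'I_(2 ^ n) -> enat) : lsc (fun x => f (code_ord n x)).
Proof. by move=> x a ax; apply: filterS (code_ord_near n x) => y ->. Qed.
End Code.

(** * The limit of the dyadic sequence *)

Lemma cylinder_min_sup (f : lsc_po cantor_space) (x : cantor_space) :
  is_seq_sup (fun n => Fin (cylinder_min f n x)) (f x).
Proof.
apply: is_seq_supI => [n|t tb]; first exact: (cylinder_minP f n x).2.
have ft k : Fin k <= f x -> Fin k <= t.
  move=> kf; have /lscP lf := @lsc_funP cantor_space f.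
  have [m mV] := nbhs_cylinder (lf _ _ kf).
  (* Level [m] makes the cylinder small enough; level [k] is needed because [cylinder_min f n] is
     capped at [n]. *)
  apply: le_trans (tb (maxn k m)).
  apply: cylinder_min_ge; first exact: leq_maxl.
  by move=> y xy; apply: mV => i im; apply: xy; rewrite leq_max im orbT.
case: (f x) ft => [k|] ft; first exact: ft.
by case: t {tb} ft => // t /(_ t.+1 isT); rewrite /Order.le /= ltnn.
Qed.

Lemma cylinder_min_leS f n x : (cylinder_min f n x <= cylinder_min f n.+1 x)%N.
Proof.
have [cn cf] := cylinder_minP f n x.
apply: cylinder_min_ge; first exact: leqW.
by move=> y xy; apply: cf => i lin; apply: xy; exact: ltnW.
Qed.

Definition dyadic_lsc n (f : seq_ob dyadic n) : Lsc_cantor := lsc_mk (@code_lsc n f).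

Lemma dyadic_lsc_morphism n : cu_morphism (@dyadic_lsc n).
Proof.
apply: (@simplicial_cu_morphism (2 ^ n)).
- exact: val_inj.
- by move=> f g; exact: val_inj.
- by move=> f g /lefP fg; apply/lsc_leP => x; exact: fg.
- by move=> z s _ /simplicial_supP zs; apply/lsc_supP => x; exact: zs.
- move=> a; apply: lsc_cantor_compact => x; exists (a (code_ord n x)); split=> //.
  by apply: filterS (code_ord_near n x) => y /= ->.
Qed.

(** Order is reflected because every index is the code of a point, namely its [decode]; the cylinder
    minima of [f] supply the approximating sequence. *)
Lemma dyadic_lsc_limit : cu_limit dyadic_lsc.
Proof.
apply: cu_limit_criterion.
- split=> [n|i j ij f]; first exact: dyadic_lsc_morphism.
  by apply: val_inj; apply/funext => x; congr (f _); exact: dyadic_res_code.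
- move=> n f g /lsc_leP fg; apply/lefP => k.
  by have := fg (decode k); rewrite /= code_ord_decode.
- move=> f; exists (fun n k => Fin (cylinder_min f n (decode k))); split=> [n|].
    (* The next term is finite-valued, hence compact, so an inequality suffices. *)
    apply: way_below_le_l (@simplicial_Fin_compact _ _).
    apply/lefP => k; apply: le_trans (_ : Fin (cylinder_min f n (decode k)) <= _).
      (* Reducing [k] modulo [2 ^ n] before decoding keeps the point in the same cylinder of level
         [n]. *)
      rewrite /Order.le /= (@cylinder_min_agree f n _ (decode k))//.
      have := @agree_decode n (decode k); rewrite code_decode => ak i lin.
      by rewrite ak.
    exact: cylinder_min_leS.
  apply/lsc_supP => x; have := cylinder_min_sup f x.
  congr (is_seq_sup _ _); apply/funext => n /=.
  by rewrite (cylinder_min_agree f (@agree_decode n x)).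
Qed.

Theorem corollary4p29 : fraisse_limit K_cantor Lsc_cantor.
Proof.
split=> [|S Sfr]; first by exists dyadic; exact: dyadic_fraisse.
have exA := K_cantor_exact_fraisse dyadic_fraisse.
apply: (transfer_limit exA (K_cantor_exact_fraisse Sfr)) dyadic_lsc_limit.
(* Stage 0 of [dyadic] has the single index of ['I_1], onto which any nonempty index set surjects.
   Exactness of [dyadic] then yields the initial arrow from [S] back into [dyadic]. *)
have point_hom : @sub_hom _ K_cantor (dyadic_idx 0) (seq_idx S 0)
    (simplicial_pull (fun=> ord0)).
  apply: simplicial_pull_hom => k; exists (Ordinal (svalP (seq_idx S 0))).
  by rewrite (ord1 k).
have [n _ [alpha ahom _]] := exA 0%N _ _ point_hom.
by exists n, alpha.
Qed.
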